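(* Algorithm 2, on input a problem instance $T=(N_1,\ldots,N_t)$ of CPTs for $V_n$ and a set $P\subseteq\{V_1,\ldots,V_{n-1}\}$, runs in time $O\big(2^{|P|}\cdot\sum_{s=1}^t|\mathrm{CPT}(N_s,V_n)|\big)$. In particular, if $|P|\le\max\{|Pa(N_s,V_n)|\mid 1\le s\le t\}$, it runs in time polynomial in $\sum_{s=1}^t|\mathrm{CPT}(N_s,V_n)|$. Moreover, Algorithm 1 runs in polynomial time.
   Context: Binary attributes $V_1,\ldots,V_n$, each with domain $\{0,1\}$. For $Q\subseteq\{V_1,\ldots,V_{n-1}\}$, $\mathrm{Inst}(Q)$ is the set of assignments of values in $\{0,1\}$ to the attributes of $Q$ (contexts); two contexts are consistent if they agree on their common attributes. A (complete) CPT $N$ for $V_n$ consists of a parent set $Pa(N,V_n)\subseteq\{V_1,\ldots,V_{n-1}\}$ and, for each $\gamma\in\mathrm{Inst}(Pa(N,V_n))$, exactly one rule, either $\gamma:0\succ 1$ or $\gamma:1\succ 0$; it is given as the list of its rules, and its size $|\mathrm{CPT}(N,V_n)|$ is its number of rules. A swap over $V_n$ is identified with an element $x\in\{0,1\}^{n-1}$; the vote of $N$ on $x$ is $0$ if the rule of $N$ whose context agrees with $x$ on $Pa(N,V_n)$ is of the form $\gamma:0\succ1$, and $1$ otherwise. $\Delta(N,N')$ is the number of swaps on which $N,N'$ vote differently, and for $T=(N_1,\ldots,N_t)$, $f_T(N)=\sum_{s=1}^t\Delta(N,N_s)$. Algorithm 2, on input $(T,P)$: for each $\gamma\in\mathrm{Inst}(P)$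 it computes $\mathit{zerovotes}(\gamma)=\sum_{s=1}^t r_s(\gamma)\cdot 2^{\,n-|Pa(N_s,V_n)|-1}/2^{\,|P\setminus Pa(N_s,V_n)|}$, where $r_s(\gamma)$ is the number of rules of $N_s$ of the form $\delta:0\succ1$ with $\delta$ consistent with $\gamma$, and $\mathit{onevotes}(\gamma)=t\cdot2^{\,n-|P|-1}-\mathit{zerovotes}(\gamma)$; it puts $\gamma:0\succ1$ into the output CPT (parent set $P$) if $\mathit{zerovotes}(\gamma)>\mathit{onevotes}(\gamma)$ and $\gamma:1\succ0$ otherwise; finally it removes irrelevant parents (attributes of $P$ on whose value the rule's preference never depends). Algorithm 1, on input $T$: for each $s\in\{1,\ldots,t\}$ it computes (via Algorithm 2 with $P=Pa(N_s,V_n)$) a CPT $N^*_s$ minimizing $f_T$ among all CPTs for $V_n$ with parent set contained in $Pa(N_s,V_n)$, and outputs some $N^*_{s^*}$ with $f_T(N^*_{s^*})=\min_s f_T(N^*_s)$. *)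

(* Defs.v *)
From mathcomp Require Import all_boot all_order all_algebra zify.

Set Implicit Arguments.
Unset Strict Implicit.
Unset Printing Implicit Defensive.

(* The attributes V_1, ..., V_{n-1} are the elements of 'I_n.-1.  A context is
   a partial assignment, and Inst Q is the set of contexts with domain Q. *)
Definition context (n : nat) := {ffun 'I_n.-1 -> option bool}.

Definition Inst (n : nat) (Q : {set 'I_n.-1}) : {set context n} :=
  [set g : context n | [forall i, (g i != None) == (i \in Q)]].

Definition consistent (n : nat) (g d : context n) : bool :=
  [forall i, [|| g i == None, d i == None | g i == d i]].

(* A rule pairs its context with the preferred value of V_n: (g, false) is
   g : 0 > 1 and (g, true) is g : 1 > 0. *)
Definition rule (n : nat) := (context n * bool)%type.

Record cpt (n : nat) : Type :=
  Cpt { parents : {set 'I_n.-1}; rules : seq (rule n) }.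

Definition cpt_size (n : nat) (N : cpt n) : nat := size (rules N).

Definition complete (n : nat) (N : cpt n) : Prop :=
  (forall r : rule n, r \in rules N -> r.1 \in Inst (parents N)) /\
  (forall g : context n, g \in Inst (parents N) ->
     count (fun r : rule n => r.1 == g) (rules N) = 1).

Definition swap (n : nat) := {ffun 'I_n.-1 -> bool}.

Definition agree_on (n : nat) (Q : {set 'I_n.-1}) (g : context n)
    (x : swap n) : bool :=
  [forall i in Q, g i == Some (x i)].

(* The default rule of nth is never reached when N is complete. *)
Definition vote (n : nat) (N : cpt n) (x : swap n) : bool :=
  let agreeing := fun r : rule n => agree_on (parents N) r.1 x in
  (nth ([ffun=> None], true) (rules N) (find agreeing (rules N))).2.

Definition Delta (n : nat) (N N' : cpt n) : nat :=
  #|[set x : swap n | vote N x != vote N' x]|.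

Definition total_disagreement (n : nat) (T : seq (cpt n)) (N : cpt n) : nat :=
  \sum_(N' <- T) Delta N N'.

Definition zero_rules (n : nat) (N : cpt n) (g : context n) : nat :=
  count (fun r : rule n => ~~ r.2 && consistent r.1 g) (rules N).

Definition zerovotes (n : nat) (T : seq (cpt n)) (P : {set 'I_n.-1})
    (g : context n) : nat :=
  \sum_(N <- T) (zero_rules N g * 2 ^ (n - #|parents N| - 1))
                  %/ 2 ^ #|P :\: parents N|.

Definition onevotes (n : nat) (T : seq (cpt n)) (P : {set 'I_n.-1})
    (g : context n) : nat :=
  size T * 2 ^ (n - #|P| - 1) - zerovotes T P g.

Definition majority (n : nat) (T : seq (cpt n)) (P : {set 'I_n.-1})
    (g : context n) : bool :=
  ~~ (onevotes T P g < zerovotes T P g).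

Definition assign (n : nat) (g : context n) (v : 'I_n.-1) (b : bool) :
    context n :=
  [ffun i => if i == v then Some b else g i].

Definition erase (n : nat) (g : context n) (v : 'I_n.-1) : context n :=
  [ffun i => if i == v then None else g i].

Definition restrict (n : nat) (g : context n) (Q : {set 'I_n.-1}) :
    context n :=
  [ffun i => if i \in Q then g i else None].

Definition relevant (n : nat) (P : {set 'I_n.-1}) (pref : context n -> bool)
    (v : 'I_n.-1) : bool :=
  [exists g in Inst P, pref (assign g v false) != pref (assign g v true)].

(* Running time is counted on a unit-cost random access machine with words of
   Theta(n + log t) bits.  Attribute sets and contexts are bit vectors of length
   n - 1, and all numbers that occur are at most t * 2 ^ n, so each of them
   occupies a constant number of words and each instruction below is a constant
   number of word operations (Pow2 is a shift, Card a population count, and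
   consistency of two contexts is a mask-and-compare).  Arrays can be read at an
   arbitrary position and extended at their end.  Branching on a computed bit and
   moving, pairing or projecting already computed values are charged to the
   instructions that they accompany. *)
Inductive instr (n : nat) : Type -> Type :=
| Add of nat & nat : instr n nat
| Sub of nat & nat : instr n nat
| Mul of nat & nat : instr n nat
| Div of nat & nat : instr n nat
| Pow2 of nat : instr n nat
| Less of nat & nat : instr n bool
| SameBit of bool & bool : instr n bool
| Union of {set 'I_n.-1} & {set 'I_n.-1} : instr n {set 'I_n.-1}
| Minus of {set 'I_n.-1} & {set 'I_n.-1} : instr n {set 'I_n.-1}
| Remove of {set 'I_n.-1} & 'I_n.-1 : instr n {set 'I_n.-1}
| Card of {set 'I_n.-1} : instr n nat
| Consistent of context n & context n : instr n bool
| IsOne of context n & 'I_n.-1 : instr n bool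
| Assign of context n & 'I_n.-1 & bool : instr n (context n)
| Erase of context n & 'I_n.-1 : instr n (context n)
| EmptyContext : instr n (context n)
| Push (A : Type) of seq A & A : instr n (seq A)
| ReadBit of seq bool & nat : instr n bool.

Definition effect (n : nat) (A : Type) (i : instr n A) : A :=
  match i in instr _ A return A with
  | Add a b => a + b
  | Sub a b => a - b
  | Mul a b => a * b
  | Div a b => a %/ b
  | Pow2 a => 2 ^ a
  | Less a b => a < b
  | SameBit a b => a == b
  | Union Q Q' => Q :|: Q'
  | Minus Q Q' => Q :\: Q'
  | Remove Q v => Q :\ v
  | Card Q => #|Q|
  | Consistent g d => consistent g d
  | IsOne g v => g v == Some true
  | Assign g v b => assign g v b
  | Erase g v => erase g v
  | EmptyContext => [ffun=> None]
  | Push _ s x => rcons s x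
  | ReadBit s k => nth false s k
  end.

Record timed (A : Type) : Type := Timed { value : A; time : nat }.

Definition ret (A : Type) (x : A) : timed A := Timed x 0.

Definition bind (A B : Type) (p : timed A) (f : A -> timed B) : timed B :=
  let q := f (value p) in Timed (value q) (time p + time q).

Notation "'let*' x := p 'in' q" := (bind p (fun x => q))
  (at level 200, x name, p at level 100, q at level 200, right associativity).

Definition exec (n : nat) (A : Type) (i : instr n A) : timed A :=
  Timed (effect i) 1.

(* Every iteration of a loop costs one step in addition to its body, and so
   does the final exit from the loop.  Loops run over an array or, as
   for_each (enum P), over the members of an attribute set. *)
Fixpoint for_each (A S : Type) (s : seq A) (acc : S)
    (body : S -> A -> timed S) : timed S :=
  if s is x :: s' then
    let* acc' := body acc x in
    let* res := for_each s' acc' body in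
    Timed res 1
  else Timed acc 1.

Section Algorithms.

Variable n : nat.
Implicit Types (T : seq (cpt n)) (P Q : {set 'I_n.-1}) (N : cpt n).
Implicit Types (g : context n) (v : 'I_n.-1) (table : seq (rule n)).

Definition count_cpts T : timed nat :=
  for_each T 0 (fun t _ => exec (Add n t 1)).

Definition list_contexts P : timed (seq (context n)) :=
  let* g0 := exec (EmptyContext n) in
  let* l0 := exec (Push n [::] g0) in
  for_each (enum P) l0 (fun l v =>
    for_each l [::] (fun l' g =>
      let* gz := exec (Assign g v false) in
      let* go := exec (Assign g v true) in
      let* l1 := exec (Push n l' gz) in
      exec (Push n l1 go))).

Definition count_zero_rules N g : timed nat :=
  for_each (rules N) 0 (fun r d =>
    let* c := exec (Consistent d.1 g) in
    let* z := exec (SameBit n d.2 false) in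
    if z && c then exec (Add n r 1) else ret r).

Definition compute_zerovotes T P g : timed nat :=
  for_each T 0 (fun zv N =>
    let* r := count_zero_rules N g in
    let* k := exec (Card (parents N)) in
    let* e := exec (Sub n n k) in
    let* e' := exec (Sub n e 1) in
    let* w := exec (Pow2 n e') in
    let* D := exec (Minus P (parents N)) in
    let* d := exec (Card D) in
    let* w' := exec (Pow2 n d) in
    let* rw := exec (Mul n r w) in
    let* q := exec (Div n rw w') in
    exec (Add n zv q)).

Definition compute_onevotes t P (zv : nat) : timed nat :=
  let* k := exec (Card P) in
  let* e := exec (Sub n n k) in
  let* e' := exec (Sub n e 1) in
  let* w := exec (Pow2 n e') in
  let* tw := exec (Mul n t w) in
  exec (Sub n tw zv).

Definition majority_table T P : timed (seq (rule n)) :=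
  let* t := count_cpts T in
  let* l := list_contexts P in
  for_each l [::] (fun table g =>
    let* zv := compute_zerovotes T P g in
    let* ov := compute_onevotes t P zv in
    let* z := exec (Less n ov zv) in
    if z then exec (Push n table (g, false))
    else exec (Push n table (g, true))).

(* The rules whose context has v = 0, with v erased from the context, and the
   preferred values of the rules whose context has v = 1. *)
Definition split_table table v : timed (seq (rule n) * seq bool) :=
  for_each table ([::], [::]) (fun lr d =>
    let* o := exec (IsOne d.1 v) in
    if o then
      let* r := exec (Push n lr.2 d.2) in ret (lr.1, r)
    else
      let* g := exec (Erase d.1 v) in
      let* l := exec (Push n lr.1 (g, d.2)) in ret (l, lr.2)).

(* The two tables list their contexts in the same order, so it suffices to
   compare them position by position. *)
Definition same_preferences table (prefs : seq bool) : timed bool :=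
  let* res := for_each table (0, true) (fun ks d =>
    let* b := exec (ReadBit n prefs ks.1) in
    let* e := exec (SameBit n d.2 b) in
    let* k := exec (Add n ks.1 1) in
    if e then ret (k, ks.2) else ret (k, false)) in
  ret res.2.

Definition test_parent N v : timed (cpt n) :=
  let* lr := split_table (rules N) v in
  let* same := same_preferences lr.1 lr.2 in
  if same then
    let* Q := exec (Remove (parents N) v) in ret (Cpt Q lr.1)
  else ret N.

Definition remove_irrelevant P table : timed (cpt n) :=
  for_each (enum P) (Cpt P table) test_parent.

Definition algorithm2 T P : timed (cpt n) :=
  let* table := majority_table T P in
  remove_irrelevant P table.

(* Delta N N' is the sum of 2 ^ (n - |Pa(N) :|: Pa(N')| - 1) over the pairs of
   consistent rules of N and N' with opposite preferences. *)
Definition compute_Delta N N' : timed nat :=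
  let* U := exec (Union (parents N) (parents N')) in
  let* k := exec (Card U) in
  let* e := exec (Sub n n k) in
  let* e' := exec (Sub n e 1) in
  let* w := exec (Pow2 n e') in
  for_each (rules N) 0 (fun acc r =>
    for_each (rules N') acc (fun acc' r' =>
      let* c := exec (Consistent r.1 r'.1) in
      let* b := exec (SameBit n r.2 r'.2) in
      if c && ~~ b then exec (Add n acc' w) else ret acc')).

Definition compute_disagreement T N : timed nat :=
  for_each T 0 (fun acc N' =>
    let* d := compute_Delta N N' in
    exec (Add n acc d)).

Definition improve T (best : option (cpt n * nat)) N :
    timed (option (cpt n * nat)) :=
  let* N' := algorithm2 T (parents N) in
  let* f := compute_disagreement T N' in
  if best is Some b then
    let* better := exec (Less n f b.2) in
    if better then ret (Some (N', f)) else ret best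
  else ret (Some (N', f)).

(* The result is None only for the empty tuple of CPTs. *)
Definition algorithm1 T : timed (option (cpt n)) :=
  let* best := for_each T None (improve T) in
  ret (omap fst best).

End Algorithms.

(* The values computed by the timed programs: the table entries are decided by
   the majority of zerovotes and onevotes, algorithm2 keeps exactly the relevant
   parents, and algorithm1 returns a candidate of minimal total_disagreement. *)
Section Adequacy.

Variable n : nat.
Implicit Types (T : seq (cpt n)) (P Q : {set 'I_n.-1}) (N : cpt n).
Implicit Types (g : context n) (u v : 'I_n.-1) (table : seq (rule n)).
Implicit Types (vs : seq 'I_n.-1) (pref : context n -> bool).

Lemma value_for_each (A S : Type) (s : seq A) (acc : S) body :
  value (for_each s acc body) = foldl (fun a x => value (body a x)) acc s.
Proof. by elim: s acc => //= x s IHs acc; rewrite IHs. Qed.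

Lemma value_for_each_sum (A : Type) (s : seq A) k body (F : A -> nat) :
  (forall a x, value (body a x) = a + F x) ->
  value (for_each s k body) = k + \sum_(x <- s) F x.
Proof.
move=> bodyE; rewrite value_for_each.
elim: s k => [|x s IHs] k /=; first by rewrite big_nil addn0.
by rewrite IHs big_cons bodyE addnA.
Qed.

Lemma value_count_cpts T : value (count_cpts T) = size T.
Proof. by rewrite (@value_for_each_sum _ _ _ _ (fun=> 1)) // sum1_size. Qed.

Lemma value_count_zero_rules N g : value (count_zero_rules N g) = zero_rules N g.
Proof.
rewrite (@value_for_each_sum _ _ _ _ (fun d : rule n => ~~ d.2 && consistent d.1 g)).
  rewrite add0n /zero_rules -sum1_count [RHS]big_mkcond /=.
  by apply: eq_bigr => d _; case: ifP.
by move=> k [d b] /=; case: b; case: (consistent d g); rewrite ?addn0.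
Qed.

Lemma value_compute_zerovotes T P g :
  value (compute_zerovotes T P g) = zerovotes T P g.
Proof.
rewrite (@value_for_each_sum _ _ _ _ (fun N => (zero_rules N g
  * 2 ^ (n - #|parents N| - 1)) %/ 2 ^ #|P :\: parents N|)) //.
by move=> k N /=; rewrite value_count_zero_rules.
Qed.

(* The contexts produced by list_contexts, the last attribute varying fastest. *)
Fixpoint insts vs : seq (context n) :=
  if vs is v :: vs' then
    flatten [seq [:: assign g v false; assign g v true] | g <- insts vs']
  else [:: [ffun=> None]].

Lemma value_list_contexts P : value (list_contexts P) = insts (rev (enum P)).
Proof.
rewrite /= value_for_each /=.
rewrite -[enum P in LHS]revK foldl_rev.
elim: (rev _) => //= v vs ->; rewrite value_for_each /=.
set F := (F in foldl F).
suff FE (s l : seq (context n)) : foldl F l s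
    = l ++ flatten [seq [:: assign g v false; assign g v true] | g <- s].
  by rewrite FE.
by elim: s l => [|g s IHs] l /=; rewrite ?cats0 // IHs /= !cat_rcons.
Qed.

Lemma value_majority_table T P :
  value (majority_table T P)
  = [seq (g, majority T P g) | g <- insts (rev (enum P))].
Proof.
rewrite -value_list_contexts -[RHS]cat0s.
rewrite /majority_table; cbn [bind value]; rewrite value_for_each.
set F := (F in foldl F).
have FE l g : F l g = rcons l (g, majority T P g).
  rewrite /F /bind /exec; cbn [value effect compute_onevotes bind].
  rewrite /compute_onevotes /=.
  rewrite value_compute_zerovotes value_count_cpts /majority /onevotes.
  by case: ifP.
move: (value (list_contexts P)) [::] => s.
by elim: s => [|g s IHs] l /=; rewrite ?cats0 // IHs FE cat_rcons.
Qed.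

Lemma insts_dom vs g i : g \in insts vs -> (g i != None) = (i \in vs).
Proof.
elim: vs g => [|v vs IHvs] g /=; first by rewrite inE => /eqP->; rewrite ffunE.
case/flatten_mapP => g' g'P; rewrite !inE => /orP[]/eqP->; rewrite ffunE;
  by case: (i =P v) => //= _; apply: IHvs.
Qed.

Lemma assign_id g v b : g v = Some b -> assign g v b = g.
Proof. by move=> gv; apply/ffunP=> i; rewrite ffunE; case: eqP => // ->. Qed.

Lemma assign_erase g v b : assign (erase g v) v b = assign g v b.
Proof. by apply/ffunP=> i; rewrite !ffunE; case: eqP. Qed.

Lemma erase_assign g v b : g v = None -> erase (assign g v b) v = g.
Proof. by move=> gv; apply/ffunP=> i; rewrite !ffunE; case: eqP => // ->. Qed.

Lemma assignC g u v a b : u != v ->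
  assign (assign g u a) v b = assign (assign g v b) u a.
Proof.
move=> /negPf uv; apply/ffunP=> i; rewrite !ffunE.
by case: eqP => // ->; rewrite eq_sym uv.
Qed.

Lemma mem_insts vs g : (forall i, (g i != None) = (i \in vs)) -> g \in insts vs.
Proof.
elim: vs g => [|v vs IHvs] g gP /=.
  by rewrite inE; apply/eqP/ffunP=> i; rewrite ffunE; apply/eqP/negPn; rewrite gP.
have [b gv]: exists b, g v = Some b.
  by have := gP v; rewrite mem_head; case: (g v) => // b _; exists b.
apply/flatten_mapP; case vvs: (v \in vs).
  exists g; first by apply: IHvs => i; rewrite gP inE; case: eqP => // ->.
  by case: b gv => gv; rewrite !inE (assign_id gv) eqxx ?orbT.
exists (erase g v).
  apply: IHvs => i; rewrite ffunE; case: (i =P v) => [->|/eqP iv] /=.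
    by rewrite vvs.
  by rewrite gP inE (negPf iv).
by rewrite !assign_erase; case: b gv => gv; rewrite !inE (assign_id gv) eqxx ?orbT.
Qed.

Lemma InstP Q g : reflect (forall i, (g i != None) = (i \in Q)) (g \in Inst Q).
Proof. by rewrite inE; apply: (iffP 'forall_eqP). Qed.

Lemma mem_insts_Inst vs Q g : Q =i vs -> (g \in insts vs) = (g \in Inst Q).
Proof.
move=> eqQ; apply/idP/InstP => [gP i | gP].
  by rewrite eqQ; apply: insts_dom.
by apply: mem_insts => i; rewrite gP eqQ.
Qed.

Lemma size_insts vs : size (insts vs) = 2 ^ size vs.
Proof.
elim: vs => //= v vs IHvs; rewrite size_flatten /shape -map_comp.
rewrite (eq_map (g := fun=> 2)) // -[X in _ = 2 ^ X]/(size vs).+1 expnS -IHvs.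
by elim: (insts vs) => //= g s ->; lia.
Qed.

Lemma filter_insts vs v b : uniq vs -> v \in vs ->
  [seq g : context n <- insts vs | (g v == Some true) == b]
  = [seq assign g v b | g <- insts [seq u <- vs | u != v]].
Proof.
elim: vs => //= u vs IHvs /andP[uvs uniq_vs].
rewrite inE eq_sym; case: (u =P v) => [<- _|/eqP uv /= vvs] /=.
  have -> : [seq w <- vs | w != u] = vs.
    by apply/all_filterP/allP=> w wvs; apply: contraNneq uvs => <-.
  elim: (insts vs) => //= g s IHs; rewrite !ffunE !eqxx /=.
  by case: b {IHvs} IHs => /= ->.
have IH := IHvs uniq_vs vvs.
pose ext g := [:: assign g u false; assign g u true].
have vu: (v == u) = false by rewrite eq_sym (negPf uv).
have -> : [seq assign g v b | g <- flatten [seq ext g | g <- insts [seq w <- vs | w != v]]]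
    = flatten [seq ext g | g <- [seq assign g v b | g <- insts [seq w <- vs | w != v]]].
  rewrite map_flatten -!map_comp; congr flatten; apply: eq_map => g /=.
  by rewrite /ext !(assignC _ _ _ uv).
rewrite -{}IH {IHvs}.
elim: (insts vs) => //= g s IHs; rewrite !ffunE vu.
by case: (_ == b) => /=; rewrite IHs.
Qed.

Lemma value_split_table vs v pref : uniq vs -> v \in vs ->
  let vs' := [seq u <- vs | u != v] in
  value (split_table [seq (g, pref g) | g <- insts vs] v)
  = ([seq (g, pref (assign g v false)) | g <- insts vs'],
     [seq pref (assign g v true) | g <- insts vs']).
Proof.
move=> uniq_vs vvs vs'; rewrite value_for_each /=.
set F := (F in foldl F).
have FE : forall (s : seq (context n)) (l : seq (rule n)) (r : seq bool),
    foldl F (l, r) [seq (g, pref g) | g <- s]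
    = (l ++ [seq (erase g v, pref g) | g : context n <- s & (g v == Some true) == false],
       r ++ [seq pref g | g : context n <- s & (g v == Some true) == true]).
  elim=> [|g s IHs] l r /=; first by rewrite !cats0.
  rewrite {2}/F /=; case: (g v == Some true) => /=; rewrite IHs /=.
    by rewrite cat_rcons.
  by rewrite cat_rcons.
rewrite FE !filter_insts // -!map_comp /=; congr (_, _).
apply/eq_in_map => g /(insts_dom v); rewrite mem_filter eqxx /= => /negPn/eqP gv.
by rewrite erase_assign.
Qed.

Lemma value_same_preferences (s : seq (context n)) pref pref' :
  value (same_preferences [seq (g, pref g) | g <- s] [seq pref' g | g <- s])
  = all (fun g => pref g == pref' g) s.
Proof.
rewrite /= value_for_each /=; set F := (F in foldl F).
set r := map pref' s.
have FE : forall (s1 : seq (context n)) k b,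
    drop k r = map pref' s1 ->
    (foldl F (k, b) [seq (g, pref g) | g <- s1]).2
    = b && all (fun g => pref g == pref' g) s1.
  elim=> [|g s1 IHs] k b /= drE; first by rewrite andbT.
  have kr : nth false r k = pref' g.
    by have := nth_drop k false r 0; rewrite drE /= addn0.
  have dr1 : drop k.+1 r = map pref' s1.
    by have := drop_drop r 1 k; rewrite drE /= drop0 add1n.
  rewrite {2}/F /= kr addn1; case: (pref g == pref' g) => /=; rewrite IHs //=.
  by rewrite andbF.
by rewrite FE // drop0.
Qed.

Lemma relevant_restrict P pref vs h v : {subset vs <= P} -> v \in vs ->
  (forall g, g \in Inst P -> pref g = h (restrict g [set u in vs])) ->
  relevant P pref v =
  ~~ all (fun g => h (assign g v false) == h (assign g v true))
       (insts [seq u <- vs | u != v]).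
Proof.
move=> sub vvs hP; have vP := sub _ vvs.
have AP g b : g \in Inst P -> assign g v b \in Inst P.
  move/InstP=> gP; apply/InstP=> i; rewrite ffunE.
  by case: (i =P v) => [->|_]; rewrite ?vP ?gP.
rewrite -has_predC; apply/existsP/hasP => [[g /andP[gP neq]] | [g gP /= neq]].
  exists (restrict g [set u in vs | u != v]).
    apply: mem_insts => i; rewrite ffunE mem_filter !inE andbC.
    case: (boolP (_ && _)) => // /andP[_ /sub iP].
    by rewrite (InstP _ _ gP).
  move: neq; rewrite !hP ?AP //=; congr (h _ != h _);
  by apply/ffunP=> i; rewrite !ffunE !inE; case: (i =P v) => [->|]; rewrite ?vvs //= andbT.
have gd i := insts_dom i gP.
pose g' : context n :=
  [ffun i => if i \in P then if g i is None then Some false else g i else None].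
have g'P : g' \in Inst P.
  by apply/InstP=> i; rewrite ffunE; case: (i \in P) => //; case: (g i).
exists g'; rewrite g'P !hP ?AP //=; move: neq; congr (h _ != h _);
apply/ffunP=> i; rewrite !ffunE !inE; have := gd i; rewrite mem_filter;
by case: (i =P v) => [->|iv]; rewrite ?vvs //=; case ivs: (i \in vs);
  rewrite ?(sub _ ivs) //=; case: (g i).
Qed.


Lemma restrict_step g vs v b : v \in vs -> g v = Some b ->
  restrict g [set u in vs]
  = assign (restrict g [set u in [seq u <- vs | u != v]]) v b.
Proof.
move=> vvs gv; apply/ffunP=> i; rewrite !ffunE !inE mem_filter.
by case: (i =P v) => [->|]; rewrite ?vvs.
Qed.

Lemma value_test_parent vs v h : uniq vs -> v \in vs ->
  let vs' := [seq u <- vs | u != v] in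
  value (test_parent (Cpt [set u in vs] [seq (g, h g) | g <- insts vs] : cpt n) v)
  = if all (fun g => h (assign g v false) == h (assign g v true)) (insts vs')
    then Cpt [set u in vs'] [seq (g, h (assign g v false)) | g <- insts vs']
    else Cpt [set u in vs] [seq (g, h g) | g <- insts vs].
Proof.
move=> uvs vvs vs'.
have := value_same_preferences (insts vs')
  (fun g => h (assign g v false)) (fun g => h (assign g v true)).
rewrite /test_parent {1}/bind; cbn [rules]; rewrite value_split_table //.
rewrite -/vs' /bind; cbn [value fst snd] => ->; case: ifP => //= _; congr Cpt.
by apply/setP=> u; rewrite !inE mem_filter.
Qed.

Lemma value_remove_loop P pref rest vs h : uniq vs -> {subset vs <= P} ->
  uniq rest -> {subset rest <= vs} ->
  (forall g, g \in Inst P -> pref g = h (restrict g [set u in vs])) ->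
  let vs' := [seq u <- vs | (u \notin rest) || relevant P pref u] in
  exists2 h' : context n -> bool,
    foldl (fun (N : cpt n) v => value (test_parent N v))
      (Cpt [set u in vs] [seq (g, h g) | g <- insts vs]) rest
    = Cpt [set u in vs'] [seq (g, h' g) | g <- insts vs'] &
    forall g, g \in Inst P -> pref g = h' (restrict g [set u in vs']).
Proof.
elim: rest vs h => [|v rest IH] vs h uvs sub urest subr hP vs'.
  have -> : vs' = vs by apply/all_filterP/allP.
  by exists h.
have vvs : v \in vs by apply: subr; rewrite mem_head.
move: urest; rewrite cons_uniq => /andP[vrest urest].
have subr' : {subset rest <= vs} by move=> u urst; apply: subr; rewrite inE urst orbT.
rewrite [foldl _ _ _]/= value_test_parent //.
have relE := relevant_restrict sub vvs hP.
case: ifP relE => [allE /= rel | _ /= rel].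
  have [|||||h' -> h'P] := IH [seq u <- vs | u != v] (fun g => h (assign g v false)).
  - by rewrite filter_uniq.
  - by move=> u; rewrite mem_filter => /andP[_ /sub].
  - by [].
  - move=> u urst; rewrite mem_filter subr' // andbT.
    by apply: contraNneq vrest => <-.
  - move=> g gP; have vP := sub _ vvs.
    have [b gv] : exists b, g v = Some b.
      by have := InstP _ _ gP v; rewrite vP; case: (g v) => // b _; exists b.
    rewrite hP // (restrict_step vvs gv); case: b {gv} => //.
    apply/esym/eqP; apply: (allP allE); apply: mem_insts => i.
    rewrite ffunE inE; case: ifP => //; rewrite mem_filter => /andP[_ /sub].
    by rewrite -(InstP _ _ gP).
  have -> : vs' = [seq u <- [seq u <- vs | u != v] | (u \notin rest) || relevant P pref u].
    rewrite -filter_predI; apply: eq_filter => u /=; rewrite inE negb_or.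
    by case: (u =P v) => [->|]; rewrite ?rel ?andbF ?andbT.
  by exists h'.
have [h' -> h'P] := IH vs h uvs sub urest subr' hP.
have -> : vs' = [seq u <- vs | (u \notin rest) || relevant P pref u].
  apply: eq_filter => u /=; rewrite inE negb_or.
  by case: (u =P v) => [->|]; rewrite ?rel ?orbT.
by exists h'.
Qed.

Lemma uniq_insts vs : uniq vs -> uniq (insts vs).
Proof.
elim: vs => //= v vs IHvs /andP[vvs /IHvs uI].
pose f g b := assign g v b.
have -> : flatten [seq [:: assign g v false; assign g v true] | g <- insts vs]
  = [seq f g b | g <- insts vs, b <- [:: false; true]] by [].
apply: allpairs_uniq => // x y /allpairsP[[a c] [aI _ ->]].
case/allpairsP=> [[a' c'] [a'I _ ->]] /= /ffunP eqf.
move: aI a'I eqf; cbn [fst snd] => aI a'I eqf.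
have nv a0 : a0 \in insts vs -> a0 v = None.
  by move/(insts_dom v); rewrite (negPf vvs) => /negPn/eqP.
congr (_, _); last by have := eqf v; rewrite !ffunE eqxx => -[].
apply/ffunP=> i; have := eqf i; rewrite !ffunE.
by case: (i =P v) => // -> _; rewrite !nv.
Qed.

Lemma complete_insts vs h : uniq vs ->
  complete (Cpt [set u in vs] [seq (g, h g) | g <- insts vs] : cpt n).
Proof.
move=> uvs; split=> [r /mapP[g gI ->] | g gI] /=.
  by rewrite -(mem_insts_Inst (vs := vs)) // => i; rewrite inE.
rewrite count_map (eq_count (a2 := pred1 g)) //.
by rewrite count_uniq_mem ?uniq_insts // (mem_insts_Inst (Q := [set u in vs])) ?gI // => i;
   rewrite inE.
Qed.

Lemma value_algorithm2 T P :
  let N := value (algorithm2 T P) in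
  [/\ parents N = [set v in P | relevant P (majority T P) v],
      complete N
    & forall g, g \in Inst P ->
        (restrict g (parents N), majority T P g) \in rules N].
Proof.
rewrite /algorithm2 [value _]/= value_majority_table value_for_each.
have PE : P = [set u in rev (enum P)].
  by apply/setP=> u; rewrite inE mem_rev mem_enum.
have uP : uniq (rev (enum P)) by rewrite rev_uniq enum_uniq.
have [||||h'] := @value_remove_loop P (majority T P) (enum P) (rev (enum P)) (majority T P) uP.
- by move=> u; rewrite mem_rev mem_enum.
- exact: enum_uniq.
- by move=> u; rewrite mem_rev.
- move=> g gP; congr majority; apply/ffunP=> i; rewrite ffunE -PE.
  case: ifPn => // iP; apply/eqP/negPn; rewrite (InstP _ _ gP) //.
rewrite -PE; set vs' := filter _ _ => -> h'P /=.
have vsE : [set u in vs'] = [set v in P | relevant P (majority T P) v].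
  apply/setP=> u; rewrite !inE mem_filter mem_rev mem_enum.
  by case: (u \in P); rewrite ?andbF ?andbT.
split=> //.
- by apply: complete_insts; rewrite filter_uniq.
- move=> g gP; apply/mapP; exists (restrict g [set u in vs']); last by rewrite h'P.
  apply: mem_insts => i; rewrite ffunE inE; case: ifP => //.
  rewrite mem_filter mem_rev mem_enum => /andP[_ iP].
  by rewrite (InstP _ _ gP).
Qed.

Lemma sum_count1 (A : Type) (d : A) (p : pred A) (s : seq A) (F : A -> nat) :
  count p s = 1 -> \sum_(x <- s) p x * F x = F (nth d s (find p s)).
Proof.
have sum0 s' : count p s' = 0 -> \sum_(x <- s') p x * F x = 0.
  elim: s' => [|x s' IHs]; first by rewrite big_nil.
  by rewrite big_cons /=; case: (p x) => //= /IHs ->.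
elim: s => //= x s IHs; rewrite big_cons; case: (p x) => /=.
  by rewrite add1n => -[/sum0 ->]; rewrite mul1n addn0.
by rewrite add0n => /IHs ->.
Qed.

Lemma sum_vote N x (F : bool -> nat) : complete N ->
  \sum_(r <- rules N) agree_on (parents N) r.1 x * F r.2 = F (vote N x).
Proof.
move=> [domN oneN]; pose gx : context n :=
  [ffun i => if i \in parents N then Some (x i) else None].
apply: (@sum_count1 _ _ (fun r : rule n => agree_on (parents N) r.1 x) _ (fun r => F r.2)).
rewrite -(oneN gx); last by apply/InstP=> i; rewrite ffunE; case: ifP.
apply: eq_in_count => r /domN/InstP rP; apply/forall_inP/eqP => [agr | -> i iN].
  apply/ffunP=> i; rewrite ffunE; case: ifP => [/agr/eqP // | iN].
  by apply/eqP/negPn; rewrite rP iN.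
by rewrite ffunE iN.
Qed.

Lemma sum_agree Q Q' g g' : g \in Inst Q -> g' \in Inst Q' ->
  \sum_(x : swap n) agree_on Q g x * agree_on Q' g' x
  = consistent g g' * 2 ^ (n - #|Q :|: Q'| - 1).
Proof.
move=> /InstP gQ /InstP gQ'; case: (boolP (consistent g g')) => [/forallP con | ncon]; last first.
  rewrite mul0n big1 // => x _; apply/eqP; apply: contraNT ncon.
  rewrite muln_eq0 !eqb0 negb_or !negbK => /andP[/forall_inP a /forall_inP a'].
  apply/forallP=> i; case: (boolP (i \in Q)) => [iQ|]; last by rewrite -gQ negbK => ->.
  case: (boolP (i \in Q')) => [iQ'|]; last by rewrite -gQ' negbK => ->; rewrite orbT.
  by rewrite (eqP (a _ iQ)) (eqP (a' _ iQ')) eqxx !orbT.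
pose c i := if g i is Some b then Some b else g' i.
pose C i : pred bool := fun b => if c i is Some b' then b == b' else true.
have -> : \sum_(x : swap n) agree_on Q g x * agree_on Q' g' x = #|family C|.
  rewrite -sum1_card [RHS]big_mkcond /=; apply: eq_bigr => x _.
  have -> : (x \in family C) = agree_on Q g x && agree_on Q' g' x.
    apply/familyP/andP => [xC | [/forall_inP a /forall_inP a'] i].
      split; apply/forall_inP => i; have := xC i; have := con i; rewrite /C /c -?gQ -?gQ' !unfold_in.
        by case: (g i) => // b _ /eqP ->.
      by case: (g i); case: (g' i) => //= b b'; [move/eqP=> [->]|]; move=> /eqP ->.
    have := a i; have := a' i; rewrite /C /c -?gQ -?gQ' !unfold_in.
    case: (g i) => [b _ /(_ isT)/eqP[->] // |]; case: (g' i) => // b.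
    by move=> /(_ isT)/eqP[->].
  by case: agree_on; case: agree_on.
rewrite mul1n card_family foldrE big_map big_enum /=.
rewrite (eq_bigr (fun i => if i \in ~: (Q :|: Q') then 2 else 1)); last first.
  move=> i _; rewrite !inE -gQ -gQ' /C /c.
  case: (g i) => [b|]; first by rewrite /= -(card1 b); apply: eq_card.
  case: (g' i) => [b|] /=; first by rewrite -(card1 b); apply: eq_card.
  by rewrite -card_bool; apply: eq_card.
rewrite -big_mkcond prod_nat_const cardsCs setCK card_ord; congr (2 ^ _).
by rewrite subnAC subn1.
Qed.

Lemma value_compute_Delta N N' : complete N -> complete N' ->
  value (compute_Delta N N') = Delta N N'.
Proof.
move=> cN cN'; rewrite /compute_Delta; cbn [bind value].
pose w := 2 ^ (n - #|parents N :|: parents N'| - 1).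
rewrite (@value_for_each_sum _ _ _ _ (fun r : rule n =>
  \sum_(r' <- rules N') (consistent r.1 r'.1 && (r.2 != r'.2)) * w)); last first.
  move=> k r; rewrite (@value_for_each_sum _ _ _ _ (fun r' : rule n =>
    (consistent r.1 r'.1 && (r.2 != r'.2)) * w)) // => k' r' /=.
  by case: ifP => //= _; rewrite ?mul1n ?addn0.
rewrite add0n /Delta -sum1_card [RHS]big_mkcond /=.
rewrite [RHS](eq_bigr (fun x => \sum_(r <- rules N) agree_on (parents N) r.1 x *
   \sum_(r' <- rules N') agree_on (parents N') r'.1 x * (r.2 != r'.2))); last first.
  move=> x _; rewrite (@sum_vote N x (fun b => \sum_(r' <- rules N')
    agree_on (parents N') r'.1 x * (b != r'.2))) //.
  by rewrite (@sum_vote N' x (fun b => vote N x != b)) // inE; case: ifP.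
rewrite [RHS]exchange_big /= [LHS]big_seq [RHS]big_seq; apply: eq_bigr => r rN.
under [RHS]eq_bigr do rewrite big_distrr /=.
rewrite [RHS]exchange_big /= [LHS]big_seq [RHS]big_seq; apply: eq_bigr => r' rN'.
under [RHS]eq_bigr do rewrite mulnA.
rewrite -big_distrl /= sum_agree; [|exact: cN.1|exact: cN'.1].
by rewrite -mulnb -!mulnA; congr (_ * _); rewrite mulnC.
Qed.

Lemma value_compute_disagreement (t : nat) (T : t.-tuple (cpt n)) N :
  (forall s : 'I_t, complete (tnth T s)) -> complete N ->
  value (compute_disagreement T N) = total_disagreement T N.
Proof.
move=> cT cN; rewrite (@value_for_each_sum _ _ _ _ (fun N' =>
  value (compute_Delta N N'))) // add0n /total_disagreement !big_tuple.
by apply: eq_bigr => s _; rewrite value_compute_Delta.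
Qed.

Lemma foldl_argmin (A B : Type) (x0 : A) (l : seq A) (K : A -> B) (m : B -> nat) :
  0 < size l ->
  exists2 i, i < size l &
    foldl (fun best x =>
             if best is Some b then
               if m (K x) < b.2 then Some (K x, m (K x)) else best
             else Some (K x, m (K x))) None l
    = Some (K (nth x0 l i), m (K (nth x0 l i))) /\
    forall j, j < size l -> m (K (nth x0 l i)) <= m (K (nth x0 l j)).
Proof.
elim/last_ind: l => // l x IHl _; rewrite size_rcons -cats1 foldl_cat /=.
case: l IHl => [_|y l IHl].
  by exists 0 => //; split=> // -[].
have [//|i il [-> iP]] := IHl.
case: ltnP => cmp.
  exists (size (y :: l)); first by [].
  rewrite nth_cat ltnn subnn; split=> // j; rewrite ltnS leq_eqVlt => /orP[/eqP->|jl].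
    by rewrite nth_cat ltnn subnn.
  by rewrite nth_cat jl (leq_trans (ltnW cmp)) // iP.
exists i; first exact: ltnW.
rewrite nth_cat il; split=> // j; rewrite ltnS leq_eqVlt => /orP[/eqP->|jl].
  by rewrite nth_cat ltnn subnn.
by rewrite nth_cat jl iP.
Qed.

Lemma value_algorithm1 (t : nat) (T : t.-tuple (cpt n)) :
  0 < t -> (forall s : 'I_t, complete (tnth T s)) ->
  let N_ (s : 'I_t) := value (algorithm2 T (parents (tnth T s))) in
  exists2 s : 'I_t, value (algorithm1 T) = Some (N_ s) &
    forall s' : 'I_t,
      total_disagreement T (N_ s) <= total_disagreement T (N_ s').
Proof.
move=> t0 cT N_; have sT := size_tuple T.
have [|i iT [fE fP]] := @foldl_argmin _ _ (tnth T (Ordinal t0)) T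
  (fun N => value (algorithm2 T (parents N))) (total_disagreement T).
  by rewrite sT.
move: iT fE fP; rewrite sT => iT.
have nthE (s : 'I_t) : nth (tnth T (Ordinal t0)) T s = tnth T s.
  by rewrite -tnth_nth.
rewrite (nthE (Ordinal iT)) => fE fP; exists (Ordinal iT); last first.
  by move=> s'; have := fP s' (ltn_ord s'); rewrite (nthE s').
pose step best N := let N' := value (algorithm2 T (parents N)) in
  let f := total_disagreement T N' in
  if best is Some b then if f < b.2 then Some (N', f) else best
  else Some (N', f).
have stepE best N : value (improve T best N) = step best N.
  rewrite /improve /step {1 2}/bind; cbn [value].
  have [_ cN' _] := value_algorithm2 T (parents N).
  rewrite (value_compute_disagreement cT cN').
  move: (value (algorithm2 _ _)) {cN'} => N'.
  move: (total_disagreement _ _) => f; case: best => [b|] //.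
  by rewrite /exec /bind; cbn [value effect]; case: ifP.
rewrite /algorithm1 {1}/bind; cbn [value ret]; rewrite value_for_each.
have -> l best :
    foldl (fun best N => value (improve T best N)) best l = foldl step best l.
  by elim: l best => // N l IHl best; cbn [foldl]; rewrite stepE; apply: IHl.
by rewrite fE.
Qed.

End Adequacy.

(* Main.v *)
(** Filling the majority table costs O(sum of the CPT sizes) for each of the
    2^|P| contexts.  Testing a parent costs time linear in the current table.  A
    successful test halves the table, so all successful tests together cost
    O(2^|P|) by a geometric sum.  An unsuccessful test concerns a relevant parent,
    and a relevant parent belongs to some Pa(N_s); hence at most
    sum_s |Pa(N_s)| <= sum_s 2^|Pa(N_s)| = sum_s |CPT(N_s)| tests fail.  The two
    polynomial bounds are quadratic and follow from |CPT(N)| = 2^|Pa(N)|. *)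

Require Import Defs.
From mathcomp Require Import all_boot all_order all_algebra.
From mathcomp Require Import zify.

Set Implicit Arguments.
Unset Strict Implicit.
Unset Printing Implicit Defensive.

(** * Loop costs and the size of a complete CPT *)

Lemma time_for_each (A S : Type) (F : A -> nat) (s : seq A) (acc : S) body :
  (forall a x, time (body a x) <= F x) ->
  time (for_each s acc body) <= \sum_(x <- s) (F x).+1 + 1.
Proof.
move=> bodyF; elim: s acc => [|x s IHs] acc /=; first by rewrite big_nil.
rewrite big_cons; have := bodyF acc x; have := IHs (value (body acc x)); lia.
Qed.

Lemma time_for_each_const (A S : Type) k (s : seq A) (acc : S) body :
  (forall a x, time (body a x) <= k) ->
  time (for_each s acc body) <= k.+1 * size s + 1.
Proof.
move=> bodyk; apply: leq_trans (time_for_each (F := fun=> k) _ _ bodyk) _.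
by rewrite big_const_seq count_predT iter_addn_0.
Qed.

(** Peels off one iteration, for loops whose body has a cost that depends on the accumulator and not
    only on the element. *)
Lemma time_for_each_cons (A S : Type) (x : A) (s : seq A) (acc : S) body a k :
  time (body acc x) <= a ->
  time (for_each s (value (body acc x)) body) <= k ->
  time (for_each (x :: s) acc body) <= a + (k + 1).
Proof. by move=> xa sk; apply: leq_add xa (leq_add sk _). Qed.

Section RunningTime.

Variable n : nat.
Implicit Types (T : seq (cpt n)) (P : {set 'I_n.-1}) (N : cpt n).
Implicit Types (g : context n) (u v : 'I_n.-1).

(** Completeness makes the contexts of the rules a duplicate-free enumeration of [Inst (parents N)],
    hence a permutation of [insts], whose length is known. *)
Lemma cpt_size_complete N : complete N -> cpt_size N = 2 ^ #|parents N|.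
Proof.
case=> domN oneN; rewrite cardE -size_insts /cpt_size -(size_map fst).
have mE : map fst (rules N) =i insts (enum (parents N)).
  move=> g; rewrite (mem_insts_Inst (Q := parents N)); last first.
    by move=> i; rewrite mem_enum.
  apply/mapP/idP => [[r /domN rP -> //] | /oneN oneg].
  have : has (fun r : rule n => r.1 == g) (rules N) by rewrite has_count oneg.
  by case/hasP=> r rN /eqP <-; exists r.
have uI : uniq (insts (enum (parents N))) by rewrite uniq_insts ?enum_uniq.
have uN : uniq (map fst (rules N)).
  apply: count_mem_uniq => g; rewrite count_map.
  case: (boolP (g \in _)) => [|gN].
    rewrite mE (mem_insts_Inst (Q := parents N)) => [/oneN|i]; first exact.
    by rewrite mem_enum.
  apply/eqP; rewrite -leqn0 leqNgt -has_count; apply: contra gN.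
  by case/hasP=> r rN /eqP <-; apply: map_f.
by apply/perm_size/uniq_perm.
Qed.

(** * Cost of filling the majority table *)

Lemma time_list_contexts P : time (list_contexts P) <= 8 * 2 ^ #|P| + 2.
Proof.
rewrite cardE /list_contexts; set body := (fun l v => for_each l [::] _).
have size_body l v : size (value (body l v)) = 2 * size l.
  rewrite value_for_each /= -[RHS]/(size (Nil (context n)) + _).
  elim: l [::] => [|g l IHl] l' /=; first by rewrite addn0.
  by rewrite IHl !size_rcons; lia.
have time_body l v : time (body l v) <= 5 * size l + 1.
  exact: time_for_each_const.
(* Each pass doubles the list. The term [7 * size l] strengthens the induction: doubling frees
   another [7 * size l], which covers the at most [5 * size l + 2] steps of the pass since [size l]
   is positive. *)
have loop vs l : 0 < size l ->
    time (for_each vs l body) + 7 * size l <= 8 * (size l * 2 ^ size vs).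
  elim: vs l => [|v vs IHvs] l l0 /=; first by lia.
  have := IHvs (value (body l v)); have := time_body l v.
  by rewrite size_body expnS mulnCA mulnA; lia.
have := loop (enum P) [:: [ffun=> None]] isT; rewrite /= mul1n => le8.
by rewrite addnA addnC leq_add2r; apply: leq_trans le8; apply: leq_addr.
Qed.

Lemma time_count_zero_rules N g :
  time (count_zero_rules N g) <= 4 * cpt_size N + 1.
Proof. by apply: time_for_each_const => r d /=; case: ifP. Qed.

Lemma time_compute_zerovotes T P g :
  time (compute_zerovotes T P g)
  <= 4 * (\sum_(N <- T) cpt_size N) + 13 * size T + 1.
Proof.
have -> : 4 * (\sum_(N <- T) cpt_size N) + 13 * size T
    = \sum_(N <- T) (4 * cpt_size N + 12).+1.
  by elim: T => [|N T IHT]; rewrite ?big_nil // !big_cons /=; lia.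
apply: time_for_each => zv N; have := time_count_zero_rules N g.
by rewrite /bind /exec; cbn [time value]; lia.
Qed.

Lemma time_majority_table T P :
  time (majority_table T P)
  <= 2 ^ #|P| * (4 * (\sum_(N <- T) cpt_size N) + 13 * size T + 18)
     + 2 * size T + 4.
Proof.
rewrite /majority_table {1 2}/bind; cbn [time].
have tcount : time (count_cpts T) <= 2 * size T + 1.
  exact: time_for_each_const.
have tlist := time_list_contexts P.
have -> : value (list_contexts P) = insts (rev (enum P)).
  exact: value_list_contexts.
set loop := for_each _ _ _.
suff : time loop <= (4 * (\sum_(N <- T) cpt_size N) + 13 * size T + 10)
                    * 2 ^ #|P| + 1 by lia.
have -> : 2 ^ #|P| = size (insts (rev (enum P))).
  by rewrite size_insts size_rev -cardE.
(* The 10 consists of 1 for leaving the loop of [compute_zerovotes], 6 for [compute_onevotes], 2 for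
   the comparison and the push, and 1 for the iteration. *)
rewrite [_ + 10]addnS; apply: time_for_each_const => table g.
have tzero := time_compute_zerovotes T P g.
rewrite /compute_onevotes /bind /exec; cbn [time value].
by case: ifP => _; cbn [time]; lia.
Qed.

(** * Cost of removing irrelevant parents *)

Lemma time_test_parent vs v h : uniq vs -> v \in vs ->
  time (test_parent (Cpt [set u in vs] [seq (g, h g) | g <- insts vs] : cpt n) v)
  <= 11 * 2 ^ size vs.
Proof.
move=> uvs vvs; rewrite /test_parent; cbn [rules].
set table := [seq (g, h g) | g <- insts vs].
have stable : size table = 2 ^ size vs by rewrite size_map size_insts.
have tsplit : time (split_table table v) <= 4 * 2 ^ size vs + 1.
  by rewrite -stable; apply: time_for_each_const => lr d /=; case: ifP.
(* This part is half of the table, but the crude bound suffices: with [m = 2 ^ size vs] the total is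
   at most [8 * m + 3 <= 11 * m]. *)
have ssplit : size (value (split_table table v)).1 <= 2 ^ size vs.
  rewrite value_split_table // size_map size_insts leq_exp2l //.
  by rewrite size_filter count_size.
have tsame (l : seq (rule n)) r : time (same_preferences l r) <= 4 * size l + 1.
  rewrite /same_preferences /bind; cbn [time ret]; rewrite addn0.
  by apply: time_for_each_const => ks d /=; case: ifP.
have := tsame (value (split_table table v)).1 (value (split_table table v)).2.
have := expn_gt0 2 (size vs).
by rewrite /bind; cbn [time value]; case: ifP => _; cbn [time exec ret value]; lia.
Qed.

(* A failed test pays for itself through the count of relevant parents, a
   successful one through the halving of the table: 2^k + 2^(k-1) * 2 = 2^k * 2. *)
Lemma time_remove_loop P pref rest vs h : uniq vs -> {subset vs <= P} ->
  uniq rest -> {subset rest <= vs} ->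
  (forall g, g \in Inst P -> pref g = h (restrict g [set u in vs])) ->
  time (for_each rest
    (Cpt [set u in vs] [seq (g, h g) | g <- insts vs] : cpt n) (@test_parent n))
  <= 12 * (2 ^ size vs * (2 + count (relevant P pref) rest)).
Proof.
elim: rest vs h => [|v rest IH] vs h uvs sub urest subr hP.
  by have := expn_gt0 2 (size vs); rewrite /=; lia.
have vvs : v \in vs by apply: subr; rewrite mem_head.
move: urest; rewrite cons_uniq => /andP[vrest urest].
have subr' : {subset rest <= vs} by move=> u ur; apply: subr; rewrite inE ur orbT.
have ttest := time_test_parent h uvs vvs.
have vs0 := expn_gt0 2 (size vs).
have := fun k => @time_for_each_cons _ _ v rest _ _ _ k ttest.
rewrite value_test_parent // => step.
(* The test on the current table fails exactly when [v] is relevant for the original [pref], so one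
   case split decides both the test and the count. *)
rewrite [count _ _]/= (relevant_restrict sub vvs hP).
case: ifP step => [allE | _] step; last first.
  (* The failed test and its iteration cost at most [11 * m + 1 <= 12 * m], where [12 * m] is what
     one more relevant parent adds to the bound. *)
  apply: leq_trans (step _ (IH vs h uvs sub urest subr' hP)) _.
  by move: vs0; set m := 2 ^ _; set c := count _ _; rewrite /=; nia.
have svs : size vs = (size [seq u <- vs | u != v]).+1.
  by have := perm_size (perm_to_rem vvs); rewrite rem_filter.
apply: leq_trans (step _ (IH [seq u <- vs | u != v]
  (fun g => h (assign g v false)) _ _ _ _ _)) _ => //; last first.
- by rewrite svs expnS; have := expn_gt0 2 (size [seq u <- vs | u != v]);
     set m := 2 ^ _; set c := count _ _; rewrite /=; nia.
(* The table of the contexts with [v] set to [false] still represents [pref]: if [g v] is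
   [Some true], the passed test [allE] equates the two values. *)
- move=> g gP; have vP := sub _ vvs.
  have [b gv] : exists b, g v = Some b.
    by have := InstP _ _ gP v; rewrite vP; case: (g v) => // b _; exists b.
  rewrite hP // (restrict_step vvs gv); case: b {gv} => //.
  apply/esym/eqP; apply: (allP allE); apply: mem_insts => i.
  rewrite ffunE inE; case: ifP => //; rewrite mem_filter => /andP[_ /sub].
  by rewrite -(InstP _ _ gP).
- move=> u ur; rewrite mem_filter subr' // andbT.
  by apply: contraNneq vrest => <-.
- by move=> u; rewrite mem_filter => /andP[_ /sub].
- by rewrite filter_uniq.
Qed.

Lemma time_remove_irrelevant P pref :
  time (remove_irrelevant P [seq (g, pref g) | g <- insts (rev (enum P))])
  <= 12 * (2 ^ #|P| * (2 + count (relevant P pref) (enum P))).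
Proof.
have PE : P = [set u in rev (enum P)].
  by apply/setP=> u; rewrite inE mem_rev mem_enum.
have -> : 2 ^ #|P| = 2 ^ size (rev (enum P)) by rewrite size_rev cardE.
rewrite /remove_irrelevant; set vs := rev (enum P) in PE *.
(* [P] is rewritten under the constructor only, so that [relevant P pref] keeps the original set. *)
have -> : @Cpt n P = Cpt [set u in vs] by rewrite -PE.
apply: time_remove_loop.
- by rewrite rev_uniq enum_uniq.
- by move=> u; rewrite mem_rev mem_enum.
- exact: enum_uniq.
- by move=> u; rewrite mem_rev.
- move=> g gP; congr pref; apply/ffunP=> i; rewrite ffunE -PE.
  by case: ifPn => // iP; apply/eqP/negPn; rewrite (InstP _ _ gP).
Qed.

(** * Bounding the number of relevant parents *)

Lemma zero_rules_assign N g v b : complete N -> v \notin parents N ->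
  zero_rules N (assign g v b) = zero_rules N g.
Proof.
move=> [domN _] vN; apply: eq_in_count => r /domN/InstP rP; congr (_ && _).
have rv : r.1 v = None by apply/eqP/negPn; rewrite rP.
apply: eq_forallb => i; rewrite ffunE.
by case: (i =P v) => [->|//]; rewrite rv.
Qed.

Section Instance.

Variables (t : nat) (T : t.-tuple (cpt n)).
Hypothesis completeT : forall s : 'I_t, complete (tnth T s).

Let S := \sum_(N <- T) cpt_size N.

Lemma total_sizeE : S = \sum_(s < t) 2 ^ #|parents (tnth T s)|.
Proof. by rewrite /S big_tuple; apply: eq_bigr => s _; apply: cpt_size_complete. Qed.

(** A complete CPT has at least one rule. This absorbs the terms in [t] of the later bounds into
    [S]. *)
Lemma leq_length_total_size : t <= S.
Proof.
rewrite total_sizeE -[t in t <= _]card_ord -sum1_card.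
by apply: leq_sum => s _; rewrite expn_gt0.
Qed.

(** By contraposition: no rule context mentions an attribute outside all parent sets, so changing
    its value leaves every vote count, and hence the majority, unchanged. *)
Lemma relevant_parent P v : relevant P (majority T P) v ->
  v \in \bigcup_(s < t) parents (tnth T s).
Proof.
case/existsP=> g /andP[_]; apply: contraR => vT.
have zE b : zerovotes T P (assign g v b) = zerovotes T P g.
  rewrite /zerovotes !big_tuple; apply: eq_bigr => s _.
  rewrite zero_rules_assign //; apply: contra vT => vs.
  by apply/bigcupP; exists s.
by rewrite /majority /onevotes !zE.
Qed.

Lemma count_relevant P : count (relevant P (majority T P)) (enum P) <= S.
Proof.
apply: (@leq_trans #|\bigcup_(s < t) parents (tnth T s)|).
  rewrite -size_filter cardE; apply: uniq_leq_size => [|v].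
    by rewrite filter_uniq // enum_uniq.
  by rewrite mem_filter !mem_enum => /andP[/relevant_parent vT _].
rewrite total_sizeE; elim/big_ind2: _ => [|A a B b leA leB|s _].
- by rewrite cards0.
- by apply: leq_trans (leq_card_setU _ _) _; apply: leq_add.
- exact/ltnW/ltn_expl.
Qed.

(** * Total running times *)

Lemma time_algorithm2 P : 0 < t ->
  time (algorithm2 T P) <= 77 * (2 ^ #|P| * S).
Proof.
move=> t0; rewrite /algorithm2 {1}/bind; cbn [time].
rewrite value_majority_table.
have := time_remove_irrelevant P (majority T P).
have := time_majority_table T P; rewrite size_tuple -/S.
have := count_relevant P; have := leq_length_total_size.
(* From [1 <= t <= S] and [1 <= m], the table costs at most [41 * (m * S)] and the removal at most
   [12 * (m * (2 + S)) <= 36 * (m * S)]. *)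
have := expn_gt0 2 #|P|; set m := 2 ^ _; nia.
Qed.

Lemma time_compute_disagreement N : 0 < t -> 0 < cpt_size N ->
  time (compute_disagreement T N) <= 15 * (cpt_size N * S).
Proof.
move=> t0 N0.
have tDelta N' : time (compute_Delta N N')
    <= 6 + (4 * cpt_size N' + 2) * cpt_size N.
  rewrite /compute_Delta /bind; cbn [time value].
  set loop := for_each _ _ _.
  suff : time loop <= (4 * cpt_size N' + 2) * cpt_size N + 1.
    by cbn [time exec]; lia.
  rewrite [_ + 2]addnS; apply: time_for_each_const => acc r.
  by apply: time_for_each_const => acc' r' /=; case: ifP.
have tloop : time (compute_disagreement T N)
    <= \sum_(N' <- T) (7 + (4 * cpt_size N' + 2) * cpt_size N).+1 + 1.
  apply: time_for_each => acc N'; have := tDelta N'.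
  by rewrite /bind; cbn [time exec]; lia.
have sumE (T' : seq (cpt n)) :
    \sum_(N' <- T') (7 + (4 * cpt_size N' + 2) * cpt_size N).+1
    = 4 * (cpt_size N * \sum_(N' <- T') cpt_size N')
      + (8 + 2 * cpt_size N) * size T'.
  by elim: T' => [|N' T' IH]; rewrite ?big_nil ?muln0 // !big_cons IH /=; nia.
apply: leq_trans tloop _; rewrite sumE size_tuple -/S.
by have := leq_length_total_size; nia.
Qed.

(** The candidate has its parents inside [parents N], hence at most [2 ^ #|parents N|] rules. The
    constant is 77 for computing it, 15 for evaluating it and 1 for the comparison. *)
Lemma time_improve best N : 0 < t ->
  time (improve T best N) <= 93 * (2 ^ #|parents N| * S).
Proof.
move=> t0; rewrite /improve {1 2}/bind; cbn [time].
have [paN' cN' _] := value_algorithm2 T (parents N).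
have tA := time_algorithm2 (parents N) t0.
move: (value (algorithm2 _ _)) paN' cN' => N' paN' cN'.
have sN' : cpt_size N' <= 2 ^ #|parents N|.
  rewrite cpt_size_complete // leq_exp2l // subset_leq_card // paN'.
  by apply/subsetP=> v; rewrite inE => /andP[].
have N'0 : 0 < cpt_size N' by rewrite cpt_size_complete // expn_gt0.
have tD := time_compute_disagreement t0 N'0.
have S0 : 0 < S by apply: leq_trans t0 leq_length_total_size.
have le1 (o : timed (option (cpt n * nat))) : time o <= 1 ->
    time (algorithm2 T (parents N)) + (time (compute_disagreement T N') + time o)
    <= 93 * (2 ^ #|parents N| * S).
  by move: tA tD sN' N'0; set m := 2 ^ _; set k := cpt_size _; nia.
by apply: le1; case: best => // b; rewrite /bind; cbn [time]; case: ifP.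
Qed.

Lemma time_algorithm1 : 0 < t -> time (algorithm1 T) <= 95 * S ^ 2.
Proof.
move=> t0; rewrite /algorithm1 {1}/bind; cbn [time ret]; rewrite addn0.
have S0 : 0 < S by apply: leq_trans t0 leq_length_total_size.
apply: leq_trans (time_for_each _ _ (fun best N => time_improve best N t0)) _.
(* Summing [2 ^ #|parents (tnth T s)|] over [s] gives [S], so the bound becomes
   [93 * S ^ 2 + t + 1]. *)
rewrite big_tuple (eq_bigr (fun s => 93 * S * 2 ^ #|parents (tnth T s)| + 1)).
  rewrite big_split /= -big_distrr /= -total_sizeE sum1_card card_ord.
  by have := leq_length_total_size; rewrite expnS expn1; nia.
by move=> s _; rewrite addn1 mulnAC mulnA.
Qed.

End Instance.

End RunningTime.

Theorem theorem14 :
  (exists c : nat,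
     forall (n t : nat) (T : t.-tuple (cpt n)) (P : {set 'I_n.-1}),
       0 < n -> 0 < t -> (forall s : 'I_t, complete (tnth T s)) ->
       time (algorithm2 T P)
         <= c * (2 ^ #|P| * \sum_(s < t) cpt_size (tnth T s))) /\
  (exists p : {poly nat},
     forall (n t : nat) (T : t.-tuple (cpt n)) (P : {set 'I_n.-1}),
       0 < n -> 0 < t -> (forall s : 'I_t, complete (tnth T s)) ->
       #|P| <= \max_(s < t) #|parents (tnth T s)| ->
       time (algorithm2 T P)
         <= (p.[(\sum_(s < t) cpt_size (tnth T s))%N])%R) /\
  (exists p : {poly nat},
     forall (n t : nat) (T : t.-tuple (cpt n)),
       0 < n -> 0 < t -> (forall s : 'I_t, complete (tnth T s)) ->
       time (algorithm1 T)
         <= (p.[(\sum_(s < t) cpt_size (tnth T s))%N])%R).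
Proof.
have poly2 (c S : nat) : c * S ^ 2 = (c *: 'X^2 : {poly nat}).[S]%R.
  by rewrite hornerZ hornerXn.
split; last split.
- exists 77 => n t T P _ t0 cT.
  by rewrite -(big_tuple _ _ T predT); apply: time_algorithm2.
- exists (77 *: 'X^2)%R => n t T P _ t0 cT leP.
  rewrite -poly2 -(big_tuple _ _ T predT).
  apply: leq_trans (time_algorithm2 cT P t0) _.
  rewrite leq_mul2l expnS expn1 leq_mul2r; apply/orP; right; apply/orP; right.
  (* The maximum is attained since [t] is positive, so [2 ^ #|P|] is at most one summand of [S]. *)
  rewrite total_sizeE //; apply: leq_trans (leq_pexp2l _ leP) _ => //.
  have [|s ->] := eq_bigmax (fun s => #|parents (tnth T s)|).
    by rewrite card_ord.
  by rewrite (bigD1 s) //= leq_addr.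
- exists (95 *: 'X^2)%R => n t T _ t0 cT.
  by rewrite -poly2 -(big_tuple _ _ T predT); apply: time_algorithm1.
Qed.
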